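(* Let $m,n,r$ be positive integers with $r<\min(m,n)$. On the set $\mathbb{R}^{m\times n}_{\leq r}=\{X\in\mathbb{R}^{m\times n}:\operatorname{rank}(X)\leq r\}$, any matrix of rank strictly less than $r$ is apocalyptic.
   Context: Let $\mathcal{X}$ be a subset of a Euclidean space $\mathcal{E}$ (here $\mathbb{R}^{m\times n}$ with $\langle A,B\rangle=\operatorname{Tr}(A^\top B)$). Tangent cone: $\mathrm{T}_x\mathcal{X}=\{v=\lim_{k\to\infty}(z_k-x)/\tau_k : z_k\in\mathcal{X},\ \tau_k>0,\ \tau_k\to 0,\text{ the limit exists}\}$. $\operatorname{Proj}_K(v)$ is any closest point to $v$ in the closed cone $K$. For $f$ continuously differentiable, $x\in\mathcal{X}$ is stationary if $\mathrm{D}f(x)[v]\geq0$ for all $v\in\mathrm{T}_x\mathcal{X}$, and $\epsilon$-stationary if $\|\operatorname{Proj}_{\mathrm{T}_x\mathcal{X}}(-\nabla f(x))\|\leq\epsilon$. The point $x\in\mathcal{X}$ is apocalyptic if there exist a sequence $(x_k)\subseteq\mathcal{X}$ converging to $x$, a continuously differentiable function $f$, and $\epsilon_k>0$ with $\epsilon_k\to0$, such that each $x_k$ is $\epsilon_k$-stationary for $f$ on $\mathcal{X}$ but $x$ is not stationary. *)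

(* Defs.v *)
From HB Require Import structures.
From mathcomp Require Import all_boot all_order all_algebra.
From mathcomp Require Import all_classical all_reals all_analysis.
From mathcomp Require Import ring lra.
Set Implicit Arguments.
Unset Strict Implicit.
Unset Printing Implicit Defensive.
Import Order.TTheory GRing.Theory Num.Theory.
Import numFieldNormedType.Exports.
Local Open Scope classical_set_scope.
Local Open Scope ring_scope.

Section Defs.
Context {R : realType} {m n : nat}.
Implicit Types (A B V X P : 'M[R]_(m, n)) (K Xs : set 'M[R]_(m, n)).
Implicit Types (f : 'M[R]_(m, n) -> R) (eps : R).

Definition frob_dot A B : R := \tr (A^T *m B).

(* The library norm `|A| on matrices is the max norm: it induces the same
   topology and differentials, but distances and projections below need the
   Euclidean one. *)
Definition frob_norm A : R := Num.sqrt (frob_dot A A).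

Definition tangent_cone Xs X : set 'M[R]_(m, n) :=
  [set V | exists (z : nat -> 'M[R]_(m, n)) (tau : nat -> R),
    [/\ forall k, Xs (z k),
        forall k, 0 < tau k,
        tau @ \oo --> 0
      & (fun k => (tau k)^-1 *: (z k - X)) @ \oo --> V]].

(* All closest points to V in K. *)
Definition proj K V : set 'M[R]_(m, n) :=
  [set P | K P /\ forall Q, K Q -> frob_norm (V - P) <= frob_norm (V - Q)].

(* The gradient for frob_dot, see gradP. *)
Definition grad f X : 'M[R]_(m, n) :=
  \matrix_(i, j) ('d f X : 'M[R]_(m, n) -> R) (delta_mx i j).

Definition cont_diff f : Prop :=
  (forall X, differentiable f X) /\ continuous (grad f).

Definition stationary Xs f X : Prop :=
  forall V, tangent_cone Xs X V -> 0 <= ('d f X : 'M[R]_(m, n) -> R) V.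

(* All closest points have the same norm, see eps_stationaryP. *)
Definition eps_stationary Xs f eps X : Prop :=
  exists2 P, proj (tangent_cone Xs X) (- grad f X) P & frob_norm P <= eps.

Definition apocalyptic Xs X : Prop :=
  Xs X /\
  exists (x : nat -> 'M[R]_(m, n)) f (eps : nat -> R),
    [/\ (forall k, Xs (x k)) /\ x @ \oo --> X,
        cont_diff f,
        (forall k, 0 < eps k) /\ eps @ \oo --> 0,
        forall k, eps_stationary Xs f (eps k) (x k)
      & ~ stationary Xs f X].

Lemma frob_dotE A B : frob_dot A B = \sum_i \sum_j A i j * B i j.
Proof.
rewrite /frob_dot /mxtrace exchange_big; apply: eq_bigr => j _.
by rewrite mxE; apply: eq_bigr => i _; rewrite mxE.
Qed.

Lemma frob_dotC A B : frob_dot A B = frob_dot B A.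
Proof. by rewrite /frob_dot -mxtrace_tr trmx_mul trmxK. Qed.

Lemma frob_dot_ge0 A : 0 <= frob_dot A A.
Proof.
rewrite frob_dotE; apply: sumr_ge0 => i _; apply: sumr_ge0 => j _.
by rewrite -expr2 sqr_ge0.
Qed.

Lemma frob_dotBZ A B t : frob_dot (A - t *: B) (A - t *: B) =
  frob_dot A A - 2 * t * frob_dot A B + t ^+ 2 * frob_dot B B.
Proof.
have := frob_dotC A B; rewrite /frob_dot => CC.
have -> : (A - t *: B)^T = A^T - t *: B^T by rewrite linearB linearZ.
rewrite mulmxBl !mulmxBr !raddfB /=.
rewrite -!scalemxAl -!scalemxAr !mxtraceZ -CC; ring.
Qed.

Lemma gradP f X V : frob_dot (grad f X) V = ('d f X : 'M[R]_(m, n) -> R) V.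
Proof.
rewrite frob_dotE [in RHS](matrix_sum_delta V) linear_sum /=.
apply: eq_bigr => i _; rewrite linear_sum /=; apply: eq_bigr => j _.
by rewrite linearZ /= mxE mulrC.
Qed.

Lemma tangent_coneZ Xs X V t :
  0 < t -> tangent_cone Xs X V -> tangent_cone Xs X (t *: V).
Proof.
move=> t0 [z [tau [zX tau0 tauc zc]]]; exists z, (fun k => t^-1 * tau k).
split=> //; first by move=> k; rewrite mulr_gt0 ?invr_gt0.
  by rewrite -(mulr0 t^-1); apply: cvgM => //; exact: cvg_cst.
have -> : (fun k => (t^-1 * tau k)^-1 *: (z k - X)) =
          (fun k => t *: ((tau k)^-1 *: (z k - X))).
  by apply/funext => k; rewrite invfM invrK scalerA.
by apply: cvgZ => //; exact: cvg_cst.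
Qed.

Lemma proj_dot K V P : (forall Q t, 0 < t -> K Q -> K (t *: Q)) ->
  proj K V P -> frob_dot V P = frob_dot P P.
Proof.
move=> KZ [KP minP]; set b := frob_dot P P; set a := frob_dot V P.
have b0 : 0 <= b by exact: frob_dot_ge0.
have H t : 0 < t -> - 2 * a + b <= - 2 * t * a + t ^+ 2 * b.
  move=> t0; have := minP _ (KZ _ _ t0 KP).
  rewrite /frob_norm ler_sqrt ?frob_dot_ge0// -[in leLHS](scale1r P) !frob_dotBZ.
  rewrite -/a -/b; lra.
set c := a - b; set d := `|c| + b + 1.
have d0 : 0 < d by rewrite /d; have := normr_ge0 c; lra.
suff : c = 0 by rewrite /c; lra.
have Pos : 0 < 1 + c / d.
  have : - `|c| <= c by rewrite lerNl -normrN ler_norm.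
  have -> : 1 + c / d = (d + c) / d by field; rewrite gt_eqF.
  by move=> ?; rewrite divr_gt0 //; rewrite /d; lra.
have := H _ Pos.
have -> : - 2 * (1 + c / d) * a + (1 + c / d) ^+ 2 * b =
   - 2 * a + b - (c / d) ^+ 2 * (2 * d - b).
  by rewrite /c; field; rewrite gt_eqF.
have db : 0 < 2 * d - b by rewrite /d; have := normr_ge0 c; lra.
move=> le; have /eqP : (c / d) ^+ 2 == 0.
  rewrite eq_le sqr_ge0 andbT -(pmulr_lle0 _ db); lra.
by move/eqP; rewrite sqrf_eq0 mulf_eq0 invr_eq0 (gt_eqF d0) orbF => /eqP.
Qed.

Lemma proj_norm K V P Q : (forall Q t, 0 < t -> K Q -> K (t *: Q)) ->
  proj K V P -> proj K V Q -> frob_norm P = frob_norm Q.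
Proof.
move=> KZ pP pQ; have := proj_dot KZ pP; have := proj_dot KZ pQ.
case: pP pQ => KP + [KQ +] => /(_ _ KQ) + /(_ _ KP).
rewrite /frob_norm !ler_sqrt ?frob_dot_ge0//.
rewrite -(scale1r P) -(scale1r Q) !frob_dotBZ !scale1r => h1 h2 h3 h4.
congr Num.sqrt; lra.
Qed.

Lemma eps_stationaryP Xs f eps X : eps_stationary Xs f eps X <->
  proj (tangent_cone Xs X) (- grad f X) !=set0 /\
  forall P, proj (tangent_cone Xs X) (- grad f X) P -> frob_norm P <= eps.
Proof.
have KZ := fun V t (t0 : 0 < t) => @tangent_coneZ Xs X V t t0.
split=> [[P pP leP]|[[P pP] /(_ P pP)]]; last by exists P.
by split=> [|Q pQ]; [exists P | rewrite (proj_norm KZ pQ pP)].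
Qed.

End Defs.

Definition bounded_rank (R : realType) (m n r : nat) : set 'M[R]_(m, n) :=
  [set X | (\rank X <= r)%N].

(* Main.v *)
(** Let [Y] have rank exactly [r], let [y] be a left-null vector of [Y] and [z]
    a right-null vector.  If [V] is tangent at [Y] to the matrices of rank at
    most [r], then [y V z = 0]: bordering an invertible [r x r] compression of
    nearby matrices by [y] and [z] gives vanishing [(r+1) x (r+1)] minors,
    whose rescaled limit is a nonzero multiple of [y V z].  Hence the linear
    function [A |-> - y A z] is stationary at every such [Y].

    Given [X] of rank less than [r], the line joining [X] to a rank [r] matrix
    obtained by extending its normal form consists, near but away from [X], of
    rank [r] matrices sharing common nonzero null vectors [y] and [z].  At [X]
    itself the rank one direction [y^T z^T] is tangent, and the linear function
    decreases strictly along it. *)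
Require Import Defs.
From HB Require Import structures.
From mathcomp Require Import all_boot all_order all_algebra.
From mathcomp Require Import all_classical all_reals all_analysis.
From mathcomp Require Import ring lra.
Set Implicit Arguments.
Unset Strict Implicit.
Unset Printing Implicit Defensive.
Import Order.TTheory GRing.Theory Num.Theory.
Import numFieldNormedType.Exports.
Local Open Scope classical_set_scope.
Local Open Scope ring_scope.

Section MatrixLimits.
Context {R : realType} {T : Type} {F : set_system T} {FF : Filter F}.

(** A matrix neighbourhood contains a product of entrywise neighbourhoods, and a filter is stable
    under the finite intersection over index pairs. *)
Lemma mx_cvgP m n (f : T -> 'M[R]_(m, n)) (A : 'M[R]_(m, n)) :
  f x @[x --> F] --> A <-> forall i j, f x i j @[x --> F] --> A i j.
Proof.
split=> [fA i j|fA].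
  exact: (cvg_comp _ _ fA (@coord_continuous _ _ _ i j A)).
move=> U [P AP PU]; apply: filterS (fun x => PU (f x)) _.
pose Q (ij : 'I_m * 'I_n) x := P ij.1 ij.2 (f x ij.1 ij.2).
apply: filterS (filter_forall (f := Q) _ _) => [x Px i j|[i j]].
  exact: (Px (i, j)).
exact: fA (AP i j).
Qed.

Lemma cvg_mulmx m n p (f : T -> 'M[R]_(m, n)) (g : T -> 'M[R]_(n, p))
    (A : 'M[R]_(m, n)) (B : 'M[R]_(n, p)) :
  f x @[x --> F] --> A -> g x @[x --> F] --> B ->
  f x *m g x @[x --> F] --> A *m B.
Proof.
move=> /mx_cvgP fA /mx_cvgP gB; apply/mx_cvgP => i j.
rewrite mxE; under eq_fun do rewrite mxE.
by apply: (cvg_big add_continuous) => k _; apply: cvgM.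
Qed.

Lemma cvg_row_mx m n p (f : T -> 'M[R]_(m, n)) (g : T -> 'M[R]_(m, p))
    (A : 'M[R]_(m, n)) (B : 'M[R]_(m, p)) :
  f x @[x --> F] --> A -> g x @[x --> F] --> B ->
  row_mx (f x) (g x) @[x --> F] --> row_mx A B.
Proof.
move=> /mx_cvgP fA /mx_cvgP gB; apply/mx_cvgP => i j.
rewrite mxE; under eq_fun do rewrite mxE.
by case: (fintype.split j) => k; [exact: fA | exact: gB].
Qed.

Lemma cvg_det n (f : T -> 'M[R]_n) (A : 'M[R]_n) :
  f x @[x --> F] --> A -> \det (f x) @[x --> F] --> \det A.
Proof.
move=> /mx_cvgP fA; apply: (cvg_big add_continuous) => s _.
apply: cvgM; first exact: cvg_cst.
by apply: (cvg_big mul_continuous) => i _.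
Qed.

End MatrixLimits.

Section BoundedRank.
Context {R : realType}.

Lemma det_eq0_rank n (A : 'M[R]_n) : (\rank A < n)%N -> \det A = 0.
Proof.
move=> rA; apply: contraTeq rA => dA; rewrite -leqNgt mxrank_unit //.
by rewrite unitmxE unitfE.
Qed.

(** In the factorization of [A] by Gaussian elimination, [C] and [D] cancel the two invertible
    factors and keep only the pivots. *)
Lemma rank_compression m n (A : 'M[R]_(m, n)) :
  exists (C : 'M[R]_(\rank A, m)) (D : 'M[R]_(n, \rank A)), C *m A *m D = 1%:M.
Proof.
exists (pid_mx (\rank A) *m invmx (col_ebase A)).
exists (invmx (row_ebase A) *m pid_mx (\rank A)).
rewrite -[X in _ *m X *m _]mulmx_ebase !mulmxA mulmxKV ?col_ebase_unit //.
rewrite mulmxK ?row_ebase_unit // !pid_mx_id ?rank_leq_row ?rank_leq_col //.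
exact: pid_mx_1.
Qed.

Lemma tangent_cone_bounded_rank_null m n r (Y V : 'M[R]_(m, n))
    (y : 'rV[R]_m) (z : 'cV[R]_n) :
  \rank Y = r -> y *m Y = 0 -> Y *m z = 0 ->
  tangent_cone (@bounded_rank R m n r) Y V -> y *m V *m z = 0.
Proof.
move=> rY yY Yz [Z [tau [Zr tau0 tauc ZV]]].
have [C [D CYD]] := rank_compression Y.
pose W k := (tau k)^-1 *: (Z k - Y).
have ZE k : Z k = Y + tau k *: W k.
  by rewrite scalerA divff ?gt_eqF // scale1r addrC subrK.
have Wz k : W k *m z = Z k *m ((tau k)^-1 *: z).
  by rewrite -scalemxAl mulmxBl Yz subr0 scalemxAr.
have ZY : Z k @[k --> \oo] --> Y.
  rewrite -[X in _ --> X]addr0 -(scale0r V); under eq_fun do rewrite ZE.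
  by apply: cvgD; [exact: cvg_cst | exact: cvgZ].
(* The last column is divided by [tau k] so that [V] survives in the limit. As [Y *m z = 0], it is
   still [Z k] times a vector, so [M k] factors through [Z k]. *)
pose M k := col_mx C y *m row_mx (Z k *m D) (W k *m z).
have M0 k : \det (M k) = 0.
  apply: det_eq0_rank; rewrite /M Wz -mul_mx_row [X in (_ < X)%N]addn1 ltnS.
  rewrite (leq_trans (mxrankM_maxr _ _)) // (leq_trans (mxrankM_maxl _ _)) //.
  by rewrite rY; exact: Zr.
have Mc : \det (M k) @[k --> \oo] -->
          \det (col_mx C y *m row_mx (Y *m D) (V *m z)).
  apply: cvg_det; apply: cvg_mulmx; first exact: cvg_cst.
  by apply: cvg_row_mx; apply: cvg_mulmx => //; exact: cvg_cst.
have : \det (col_mx C y *m row_mx (Y *m D) (V *m z)) = 0.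
  have M0c : (fun k => \det (M k)) = fun=> 0 by apply/funext.
  rewrite M0c in Mc; exact: (cvg_unique _ Mc (cvg_cst _)).
(* The limit is block upper triangular with diagonal blocks [1%:M] and [y *m V *m z]. *)
rewrite mul_col_row !mulmxA yY mul0mx CYD det_ublock det1 mul1r det_mx11 => e.
by apply/matrixP => i j; rewrite !ord1 e mxE.
Qed.

Lemma tangent_cone0 m n (Xs : set 'M[R]_(m, n)) X :
  Xs X -> tangent_cone Xs X 0.
Proof.
move=> XsX; exists (fun=> X), harmonic.
split=> //; [exact: harmonic_gt0 | exact: cvg_harmonic |].
by under eq_fun do rewrite subrr scaler0; exact: cvg_cst.
Qed.

Lemma tangent_cone_dir m n (Xs : set 'M[R]_(m, n)) X V :
  (forall t, Xs (X + t *: V)) -> tangent_cone Xs X V.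
Proof.
move=> XsV; exists (fun k => X + harmonic k *: V), harmonic.
split=> //; [exact: harmonic_gt0 | exact: cvg_harmonic |].
under eq_fun do rewrite addrC addKr scalerA mulVf ?gt_eqF ?harmonic_gt0 // scale1r.
exact: cvg_cst.
Qed.

Lemma frob_dot_continuous m n (G : 'M[R]_(m, n)) : continuous (frob_dot G).
Proof.
have -> : frob_dot G = fun A => \sum_i \sum_j G i j * A i j.
  by apply/funext => A; exact: frob_dotE.
apply: (continuous_big add_continuous) => i _.
apply: (continuous_big add_continuous) => j _ A.
by apply: continuous_comp; [exact: coord_continuous | exact: mulrl_continuous].
Qed.

(** The linear structure lets [frob_dot G] be its own differential. *)
HB.instance Definition _ m n (G : 'M[R]_(m, n)) :=
  GRing.Linear.copy (frob_dot G) (@mxtrace R n \o mulmx G^T).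

Lemma diff_frob_dot m n (G A : 'M[R]_(m, n)) :
  'd (frob_dot G) A = frob_dot G :> ('M[R]_(m, n) -> R).
Proof. exact/diff_lin/frob_dot_continuous. Qed.

Lemma grad_frob_dot m n (G A : 'M[R]_(m, n)) : grad (frob_dot G) A = G.
Proof.
apply/matrixP => i j; rewrite mxE diff_frob_dot frob_dotE.
rewrite (bigD1 i) //= (bigD1 j) //= big1 => [|k kj]; last first.
  by rewrite mxE (negPf kj) andbF mulr0.
rewrite big1 => [|k ki]; last first.
  by apply: big1 => l _; rewrite mxE (negPf ki) mulr0.
by rewrite mxE !eqxx mulr1 !addr0.
Qed.

Lemma cont_diff_frob_dot m n (G : 'M[R]_(m, n)) : cont_diff (frob_dot G).
Proof.
split=> [A|A]; first exact/linear_differentiable/frob_dot_continuous.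
have -> : grad (frob_dot G) = cst G by apply/funext => B; exact: grad_frob_dot.
exact: cst_continuous.
Qed.

(* A gradient orthogonal to the tangent cone projects to [0]. *)
Lemma eps_stationary_frob_dot m n (Xs : set 'M[R]_(m, n)) G X eps :
  0 <= eps -> Xs X -> (forall V, tangent_cone Xs X V -> frob_dot G V = 0) ->
  eps_stationary Xs (frob_dot G) eps X.
Proof.
move=> eps0 XsX G0; exists 0; last first.
  by rewrite /frob_norm /frob_dot mulmx0 mxtrace0 sqrtr0.
split=> [|Q KQ]; first exact: tangent_cone0.
rewrite grad_frob_dot /frob_norm ler_sqrt ?frob_dot_ge0 //.
(* Both [0] and [Q] become multiples of [Q], so one expansion covers both squared distances; by
   orthogonality they differ by [frob_dot Q Q]. *)
rewrite -(scale1r Q) -(scale0r Q) !frob_dotBZ.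
have -> : frob_dot (- G) Q = 0.
  by rewrite frob_dotC raddfN /= frob_dotC G0 // oppr0.
by have := frob_dot_ge0 Q; lra.
Qed.

Lemma extend_rank m n r (X : 'M[R]_(m, n)) :
    (\rank X <= r)%N -> (r < m)%N -> (r < n)%N ->
  exists (Y : 'M[R]_(m, n)) (y : 'rV[R]_m) (z : 'cV[R]_n),
    [/\ forall t : R, t != 0 -> \rank (X + t *: (Y - X))%R = r,
        y != 0 /\ z != 0,
        y *m X = 0 /\ y *m Y = 0
      & X *m z = 0 /\ Y *m z = 0].
Proof.
set s := \rank X => sr rm rn.
pose L := col_ebase X; pose U := row_ebase X.
have Lu : L \in unitmx := col_ebase_unit X.
have Uu : U \in unitmx := row_ebase_unit X.
have XE : X = L *m pid_mx s *m U by rewrite mulmx_ebase.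
exists (L *m pid_mx r *m U).
(* Indices start at zero, so index [r] is the first one past the [r] pivots of [pid_mx r]. *)
exists (delta_mx ord0 (Ordinal rm) *m invmx L).
exists (invmx U *m delta_mx (Ordinal rn) ord0).
have dpid q : (q <= r)%N ->
    delta_mx ord0 (Ordinal rm) *m pid_mx q = 0 :> 'rV[R]_n.
  move=> qr; apply/rowP => j; rewrite -rowE !mxE /=.
  by case: eqP => //= _; rewrite ltnNge qr.
have pidd q : (q <= r)%N ->
    pid_mx q *m delta_mx (Ordinal rn) ord0 = 0 :> 'cV[R]_m.
  move=> qr; apply/colP => j; rewrite -colE !mxE /=.
  by case: eqP => //= ->; rewrite ltnNge qr.
split.
- move=> t t0; pose P : 'M[R]_m := pid_mx s.
  have PP : P *m P = P by rewrite pid_mx_id // (leq_trans sr) // ltnW.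
  (* This diagonal matrix has [1] in its first [s] places and [t] afterwards; inverting it replaces
     [t] by [t^-1]. It turns [pid_mx r] into [t *: pid_mx r + (1 - t) *: pid_mx s], the normal form
     along the line. *)
  have Dunit : t%:M + (1 - t) *: P \in unitmx.
    suff /mulmx1_unit[] :
      (t%:M + (1 - t) *: P) *m (t^-1%:M + (1 - t^-1) *: P) = 1%:M by [].
    rewrite mulmxDl !mulmxDr -!scalemxAl -!scalemxAr PP mul_scalar_mx scale_scalar_mx.
    rewrite divff // mul_scalar_mx mul_mx_scalar -addrA !scalerA -!scalerDl.
    set c := (X in X *: P); suff -> : c = 0 by rewrite scale0r addr0.
    by rewrite /c; field.
  have -> : X + t *: (L *m pid_mx r *m U - X) =
      L *m (t%:M + (1 - t) *: P) *m pid_mx r *m U.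
    have -> : X + t *: (L *m pid_mx r *m U - X) =
        t *: (L *m pid_mx r *m U) + (1 - t) *: X.
      by rewrite scalerBr scalerBl scale1r addrCA.
    rewrite XE mulmxDr !mulmxDl mul_mx_scalar -!scalemxAl -scalemxAr -!scalemxAl.
    congr (_ + _ *: (_ *m _)); rewrite -mulmxA mul_pid_mx.
    by rewrite (minn_idPl sr) (minn_idPr (rank_leq_row X)).
  rewrite mxrankMfree ?row_free_unit // -mulmxA eqmxMfull ?row_full_unit //.
  by rewrite eqmxMfull ?row_full_unit // rank_pid_mx // ltnW.
- split.
    apply: contraNneq (oner_neq0 R) => /(congr1 (mulmxr L)) /=.
    rewrite mulmxKV // mul0mx => /rowP/(_ (Ordinal rm)).
    by rewrite !mxE !eqxx => /eqP.
  apply: contraNneq (oner_neq0 R) => /(congr1 (mulmx U)).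
  rewrite mulKVmx // mulmx0 => /colP/(_ (Ordinal rn)).
  by rewrite !mxE !eqxx => /eqP.
- by rewrite XE !mulmxA !mulmxKV // !dpid // !mul0mx.
- by rewrite XE -!mulmxA !mulKVmx // !pidd // !mulmx0.
Qed.

End BoundedRank.

Theorem proposition2p10 (R : realType) (m n r : nat)
    (m_gt0 : (0 < m)%N) (n_gt0 : (0 < n)%N) (r_gt0 : (0 < r)%N)
    (r_lt : (r < minn m n)%N) (X : 'M[R]_(m, n)) (rankX : (\rank X < r)%N) :
  apocalyptic (@bounded_rank R m n r) X.
Proof.
have /andP[rm rn] : (r < m)%N && (r < n)%N by rewrite -leq_min.
have [Y [y [z [rXY [y0 z0] [yX yY] [Xz Yz]]]]] := extend_rank (ltnW rankX) rm rn.
pose E := y^T *m z^T.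
have dotE A : frob_dot (- E) A = - (y *m A *m z) ord0 ord0.
  rewrite /frob_dot linearN /= mulNmx raddfN /= /E trmx_mul !trmxK.
  by rewrite mxtrace_mulC mulmxA mxtrace_mulC trace_mx11 !mulmxA.
have E0 : frob_dot (- E) E < 0.
  have sq k (u : 'cV[R]_k) : u != 0 -> 0 < (u^T *m u) ord0 ord0.
    move=> u0; rewrite mxE; under eq_bigr do rewrite mxE -expr2.
    rewrite lt_neqAle sumr_ge0 ?andbT => [|i _]; last exact: sqr_ge0.
    apply: contra u0; rewrite eq_sym psumr_eq0 => [|i _]; last exact: sqr_ge0.
    move=> /allP u0; apply/eqP/colP => i; rewrite mxE; apply/eqP.
    by rewrite -sqrf_eq0; apply: u0; exact: mem_index_enum.
  (* The value is minus the product of the squared norms of [y] and [z]. *)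
  rewrite dotE oppr_lt0 /E !mulmxA -mulmxA [(_ *m _) ord0 ord0]mxE big_ord1.
  apply: mulr_gt0; last exact: sq.
  by rewrite -{1}(trmxK y); apply: sq; rewrite trmx_eq0.
split; first exact: ltnW.
(* [harmonic] never vanishes, so every iterate has rank exactly [r]. It also serves as the
   tolerance: the projections are [0], so any positive null sequence would do. *)
exists (fun k => X + harmonic k *: (Y - X)), (frob_dot (- E)), harmonic.
have rk k : \rank (X + harmonic k *: (Y - X))%R = r.
  by apply: rXY; rewrite gt_eqF // harmonic_gt0.
split.
- split=> [k|]; first by rewrite /bounded_rank /= rk.
  rewrite -[X in _ --> X]addr0 -(scale0r (Y - X)).
  apply: cvgD; first exact: cvg_cst.
  by apply: cvgZ; [exact: cvg_harmonic | exact: cvg_cst].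
- exact: cont_diff_frob_dot.
- by split; [exact: harmonic_gt0 | exact: cvg_harmonic].
- move=> k; apply: eps_stationary_frob_dot; first exact/ltW/harmonic_gt0.
    by rewrite /bounded_rank /= rk.
  move=> V /(@tangent_cone_bounded_rank_null _ _ _ _ _ _ y z (rk k)) V0.
  rewrite dotE V0 ?mxE ?oppr0 //.
    by rewrite mulmxDr -scalemxAr mulmxBr yX yY subrr scaler0 addr0.
  by rewrite mulmxDl -scalemxAl mulmxBl Xz Yz subrr scaler0 addr0.
- move=> /(_ E); rewrite diff_frob_dot leNgt E0.
  suff TE : tangent_cone (@bounded_rank R m n r) X E by move=> /(_ TE).
  apply: tangent_cone_dir => t; rewrite /bounded_rank /=.
  (* The strict bound on [\rank X] leaves room for the rank one term [t *: E]. *)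
  apply: leq_trans (mxrank_add _ _) _; rewrite -addn1 in rankX.
  apply: leq_trans rankX; rewrite leq_add2l.
  apply: leq_trans (mxrank_scale _ _) _.
  exact: mulmx_max_rank.
Qed.
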